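(* Let $m,k\ge0$ be integers. For all $z\in\mathbb{R}$, $$(-1)^m S_{m,k+1}(1-e^{2z})=\frac{(-2)^{k+1}}{m!\,k!}\int_0^z t^k\left(\log\left(\frac{\sinh t}{\sinh z}\right)-(z-t)\right)^m dt$$ and $$(-1)^m S_{m,k+1}(1-e^{-2z})=\frac{2^{k+1}}{m!\,k!}\int_0^z t^k\left(\log\left(\frac{\sinh t}{\sinh z}\right)+(z-t)\right)^m dt,$$ where for $z=0$ the integrals are understood as $0$.
   Context: For integers $m,k\ge1$ and $x\in\mathbb{C}\setminus[1,\infty)$ the Nielsen polylogarithm is $$S_{m,k}(x)=\frac{(-1)^{m+k-1}}{(m-1)!\,k!}\int_0^1 \log(t)^{m-1}\log(1-xt)^k\,\frac{dt}{t}$$ with the principal branch of the logarithm. For $|x|<1$, $S_{m,k}(x)=\operatorname{Li}_{m+1,\{1\}^{k-1}}(x)$, where $\operatorname{Li}_{s_1,\dots,s_k}(x)=\sum_{n_1>\cdots>n_k>0}\frac{x^{n_1}}{n_1^{s_1}\cdots n_k^{s_k}}$ and $\{1\}^{k}$ means $1$ repeated $k$ times. For $m=0$ and $k\ge1$ one sets $S_{0,k}(x)=\operatorname{Li}_{\{1\}^k}(x)=\frac{(-1)^k}{k!}\log(1-x)^k$ (principal branch). In particular $S_{m,1}=\operatorname{Li}_{m+1}$. For $z<0$, $\int_0^z$ denotes the oriented integral. Zeroth powers equal $1$. *)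

(* Defs.v *)
From Stdlib Require Import Reals Factorial.
From Coquelicot Require Import Coquelicot.

(** Principal argument, with values in (-PI, PI], and principal logarithm;
    only meaningful for [w <> 0]. *)
Definition Carg (w : C) : R :=
  if Rle_dec 0 (Im w) then acos (Re w / Cmod w)%R
  else (- acos (Re w / Cmod w))%R.

Definition Clog (w : C) : C := (ln (Cmod w), Carg w).

(** [S_{m,k}(x)] for [k >= 1] and [x] outside [[1, +oo)]. For [m = S m'] the
    exponents [m - 1] and [m + k - 1] are [m'] and [m' + k]. For such [x] the
    integrand is continuous on (0, 1], so the integral is improper only at 0. *)
Definition nielsen (m k : nat) (x : C) : C :=
  match m with
  | O => ((-1) ^ k / RtoC (INR (fact k)) * Clog (1 - x) ^ k)%C
  | S m' =>
      ((-1) ^ (m' + k) / RtoC (INR (fact m') * INR (fact k))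
       * RInt_gen (V := C_R_CompleteNormedModule)
           (fun t : R =>
              (RtoC (ln t) ^ m' * Clog (1 - x * RtoC t) ^ k / RtoC t)%C)
           (at_right 0) (at_point 1))%C
  end.

(** Oriented integral from 0 to [z] of a function that may be singular at 0
    (improper Riemann integral at that end), equal to 0 for [z = 0]. *)
Definition ex_int0 (f : R -> R) (z : R) : Prop :=
  ((0 < z)%R -> ex_RInt_gen f (at_right 0) (at_point z)) /\
  ((z < 0)%R -> ex_RInt_gen f (at_left 0) (at_point z)).

Definition int0 (f : R -> R) (z : R) : R :=
  if Rlt_dec 0 z then RInt_gen f (at_right 0) (at_point z)
  else if Rlt_dec z 0 then RInt_gen f (at_left 0) (at_point z)
  else 0%R.

(* Main.v *)
Require Import Defs.
From Stdlib Require Import Reals Factorial Lra FunctionalExtensionality.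
From Coquelicot Require Import Coquelicot.
Open Scope R_scope.

(** Put [c = exp (2 s z)] and [x = 1 - c], with [s = 1] for the first identity
    and [s = -1] for the second; both are then one statement about [s].  The
    substitution [1 - x u = exp (2 s t)], that is
    [u t = (1 - exp (2 s t)) / (1 - exp (2 s z))], carries the segment from 0 to
    [z] to the segment from 0 to 1, and
    [ln (u t) = ln (sinh t / sinh z) - s (z - t)] ([ln_sinh_ratio]).  So the
    [sinh] integral is a constant times the integral over [0 < u < 1] of
    [ln u ^ m * ln (1 - x u) ^ k / (1 - x u)].  For [m >= 1] an integration by
    parts turns the Nielsen integrand [ln u ^ (m-1) * ln (1 - x u) ^ (k+1) / u]
    into the same integrand.

    All the integrals involved are improper at 0, and the argument is arranged so
    that neither a substitution nor an integration by parts is ever performed on an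
    improper integral.  There is one function [B], vanishing at [0+], with
    derivative [ln u ^ m * ln (1 - x u) ^ k / (1 - x u)]
    ([ln_pow_antiderivative]); the [sinh] integrand has the antiderivative
    [a * B (u t)], and the Nielsen integrand has the antiderivative
    [(ln u ^ m * ln (1 - x u) ^ (k+1)) / m + ((k+1) x / m) * B u].  Both vanish at
    0, so existence and value of both integrals follow from the fundamental theorem
    of calculus ([is_RInt_gen_antiderivative]), and both values are multiples of
    [B 1].  For [m = 0] both sides are explicit powers of [z]. *)

(** * Improper integrals and antiderivatives *)

(** The fundamental theorem of calculus, for a general filter at the singular end
    so that it serves integrals from [0+] and from [0-] alike. *)
Lemma is_RInt_gen_antiderivative (F : (R -> Prop) -> Prop) (FF : Filter F)
  (f G : R -> R) (z l : R) :
  F (fun e => forall t, Rmin e z <= t <= Rmax e z ->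
                is_derive G t (f t) /\ continuous f t) ->
  filterlim G F (locally l) ->
  is_RInt_gen f F (at_point z) (G z - l).
Proof.
intros HD HG P HP.
assert (HG' : filterlim (fun e => G z - G e) F (locally (G z - l))).
{ apply (filterlim_comp_2 (G := locally (G z)) (H := locally (opp l))
      (fun _ => G z) (fun e => opp (G e)) Rplus).
  - apply filterlim_const.
  - apply (filterlim_comp _ _ _ G opp F (locally l)); [exact HG|].
    apply (filterlim_opp (V := R_NormedModule)).
  - apply (filterlim_plus (V := R_NormedModule)). }
apply Filter_prod with (Q := fun e => (forall t, Rmin e z <= t <= Rmax e z ->
                is_derive G t (f t) /\ continuous f t) /\ P (G z - G e)) (R := fun t => t = z).
- apply filter_and; [exact HD | exact (HG' P HP)].
- reflexivity.
- intros e y [H1 H2] ->. exists (G z - G e). split; [|exact H2].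
  apply (is_RInt_derive (V := R_CompleteNormedModule)); intros t Ht; now apply H1.
Qed.

(** Lets the complex integral that defines [nielsen] be computed over the reals,
    where its integrand takes its values. *)
Lemma is_RInt_gen_RtoC (F1 F2 : (R -> Prop) -> Prop) (f : R -> R) (l : R) :
  is_RInt_gen f F1 F2 l ->
  is_RInt_gen (V := C_R_NormedModule) (fun t => RtoC (f t)) F1 F2 (RtoC l).
Proof.
intros H P [eps HP].
destruct (H (fun r => P (RtoC r))) as [Q R HQ HR HQR].
- exists eps. intros y Hy. apply HP. split; [exact Hy | apply ball_center].
- apply Filter_prod with Q R; [assumption..|].
  intros a b Ha Hb. destruct (HQR a b Ha Hb) as [y [Hy HPy]].
  exists (RtoC y). split; [|exact HPy].
  apply (is_RInt_fct_extend_pair (U := R_NormedModule) (V := R_NormedModule));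
    simpl; [exact Hy|].
  evar_last; [apply (is_RInt_const (V := R_NormedModule))|]. exact (Rmult_0_r (b - a)).
Qed.

(** * Logarithmic singularities at 0 *)

(** This value off the positive reals makes [ln_sqrt] hold without hypothesis and
    [v * ln v ^ m] continuous at 0 from both sides. *)
Lemma ln_nonpos (v : R) : v <= 0 -> ln v = 0.
Proof.
intros Hv. unfold ln.
destruct (Rlt_dec 0 v) as [H|H]; [exfalso; lra | reflexivity].
Qed.

Lemma ln_sqrt (v : R) : ln v = 2 * ln (sqrt v).
Proof.
destruct (Rlt_dec 0 v) as [Hv|Hv].
- rewrite <- (sqrt_sqrt v) at 1 by lra.
  rewrite ln_mult; try (apply sqrt_lt_R0; lra). ring.
- rewrite sqrt_neg_0, !ln_nonpos by lra. ring.
Qed.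

(** Since [- ln v = 2 ln (1 / sqrt v) <= 2 / sqrt v] for [0 < v < 1], the product
    is at most [2 sqrt v] in absolute value. *)
Lemma continuous_mul_ln_at_0 : continuous (fun v => v * ln v) 0.
Proof.
apply (filterlim_locally (F := locally 0)). intros eps.
assert (Hs : continuous (fun v => 2 * sqrt v) 0).
{ apply (continuous_scal_r (V := R_NormedModule) 2 sqrt). apply continuous_sqrt. }
assert (H1 := proj1 (filterlim_locally _ _) Hs eps).
assert (H2 : locally 0 (fun v => v < 1)) by (apply (open_lt 1); lra).
generalize (filter_and _ _ H1 H2). apply filter_imp.
intros v [Hv Hv1].
change (Rabs (v * ln v - 0 * ln 0) < eps).
change (Rabs (2 * sqrt v - 2 * sqrt 0) < eps) in Hv.
rewrite Rmult_0_l, Rminus_0_r.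
destruct (Rlt_dec 0 v) as [H0|H0].
- eapply Rle_lt_trans; [|exact Hv].
  rewrite sqrt_0, Rmult_0_r, Rminus_0_r.
  assert (Hp : 0 < sqrt v) by (apply sqrt_lt_R0; lra).
  assert (Hq := sqrt_sqrt v (Rlt_le _ _ H0)).
  assert (Hneg : ln v < 0) by (rewrite <- ln_1; apply ln_increasing; lra).
  assert (Hln : - ln v <= 2 / sqrt v).
  { rewrite ln_sqrt. assert (H := exp_ineq1_le (- ln (sqrt v))).
    rewrite exp_Ropp, exp_ln in H by lra. unfold Rdiv. lra. }
  rewrite Rabs_left by nra. rewrite Rabs_pos_eq by lra.
  apply (Rmult_le_compat_l v) in Hln; [|lra].
  replace (v * (2 / sqrt v)) with (2 * sqrt v) in Hln; [lra|].
  rewrite <- Hq at 2. field. lra.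
- rewrite ln_nonpos, Rmult_0_r, Rabs_R0 by lra. apply cond_pos.
Qed.

Lemma continuous_ln (v : R) : 0 < v -> continuous ln v.
Proof. intros Hv. apply (ex_derive_continuous ln). exists (/ v). now apply is_derive_ln. Qed.

Lemma continuous_pow_comp (f : R -> R) (n : nat) (x : R) :
  continuous f x -> continuous (fun t => f t ^ n) x.
Proof.
intros Hf. induction n as [|n IH]; simpl.
- apply continuous_const.
- now apply (continuous_mult (K := R_AbsRing)).
Qed.

(** At 0, induction on [m]: with [w = sqrt v],
    [v * ln v ^ (m+1) = 2 ^ (m+1) * (w * ln w) * (w * ln w ^ m)]. *)
Lemma continuous_mul_ln_pow (m : nat) (v : R) : 0 <= v ->
  continuous (fun v => v * ln v ^ m) v.
Proof.
intros [Hv | <-].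
- apply (continuous_mult (K := R_AbsRing)); [apply continuous_id|].
  apply continuous_pow_comp. now apply continuous_ln.
- induction m as [|m IH].
  + apply (continuous_mult (K := R_AbsRing)); [apply continuous_id | apply continuous_const].
  + apply (continuous_ext (fun v =>
      2 ^ S m * ((sqrt v * ln (sqrt v)) * (sqrt v * ln (sqrt v) ^ m)))).
    { intros v. destruct (Rle_dec 0 v) as [Hv|Hv].
      - rewrite <- (sqrt_sqrt v) at 5 by lra. rewrite (ln_sqrt v), Rpow_mult_distr.
        simpl; ring.
      - rewrite sqrt_neg_0, (ln_nonpos v) by lra. simpl; ring. }
    apply (continuous_scal_r (V := R_NormedModule) (2 ^ S m)).
    apply (continuous_mult (K := R_AbsRing)).
    * apply (continuous_comp sqrt (fun v => v * ln v)); [apply continuous_sqrt|].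
      rewrite sqrt_0. exact continuous_mul_ln_at_0.
    * apply (continuous_comp sqrt (fun v => v * ln v ^ m)); [apply continuous_sqrt|].
      now rewrite sqrt_0.
Qed.

(** The substitution [u = s ^ 2] removes the singularity: it replaces
    [ln u ^ m * h u du] by [2 ^ (m+1) * (s * ln s ^ m) * h (s ^ 2) ds], whose
    integrand is continuous at [s = 0].  Hence [B u] can be taken to be a proper
    integral from 0 to [sqrt u]. *)
Lemma ln_pow_antiderivative (m : nat) (b : R) (h : R -> R) : 0 < b ->
  (forall u, 0 <= u < b -> continuous h u) ->
  exists B : R -> R,
    (forall u, 0 < u < b -> is_derive B u (ln u ^ m * h u)) /\
    filterlim B (at_right 0) (locally 0).
Proof.
intros Hb Hh.
set (q := fun s => 2 ^ S m * ((s * ln s ^ m) * h (s ^ 2))).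
assert (Hsqrt : forall u, 0 <= u -> sqrt u ^ 2 = u)
  by (intros u Hu; simpl; rewrite Rmult_1_r; now apply sqrt_sqrt).
assert (Hq : forall s, 0 <= s -> s ^ 2 < b -> continuous q s).
{ intros s Hs Hsb.
  apply (continuous_scal_r (V := R_NormedModule) (2 ^ S m)).
  apply (continuous_mult (K := R_AbsRing)); [now apply continuous_mul_ln_pow|].
  apply (continuous_comp (fun s => s ^ 2) h).
  - apply continuous_pow_comp, continuous_id.
  - apply Hh. split; [apply pow2_ge_0 | exact Hsb]. }
assert (HI : forall v, 0 <= v -> v ^ 2 < b -> is_RInt q 0 v (RInt q 0 v)).
{ intros v Hv Hvb. apply (RInt_correct (V := R_CompleteNormedModule)).
  apply (ex_RInt_continuous (V := R_CompleteNormedModule)). intros s.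
  rewrite Rmin_left, Rmax_right by lra. intros Hs. apply Hq; [lra|nra]. }
exists (fun u => RInt q 0 (sqrt u)). split.
- intros u Hu.
  assert (Hp : 0 < sqrt u) by (apply sqrt_lt_R0; lra).
  evar_last.
  + apply (is_derive_comp (RInt q 0) sqrt).
    * apply (is_derive_RInt q (RInt q 0) 0 (sqrt u)).
      -- assert (H1 : locally (sqrt u) (fun v => 0 < v)) by now apply (open_gt 0).
         assert (H2 : locally (sqrt u) (fun v => v < sqrt b))
           by (apply (open_lt (sqrt b)); apply sqrt_lt_1; lra).
         generalize (filter_and _ _ H1 H2). apply filter_imp. intros v [Hv1 Hv2].
         apply HI; [lra|]. rewrite <- (Hsqrt b) by lra. nra.
      -- apply Hq; [lra|]. rewrite Hsqrt; lra.
    * apply is_derive_sqrt; [apply is_derive_id | lra].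
  + unfold q. rewrite Hsqrt by lra. rewrite (ln_sqrt u), Rpow_mult_distr.
    unfold scal; simpl; unfold mult, one; simpl. field. lra.
(* Near 0 the integrand [q] is bounded by 1, so [|B u| <= sqrt u]. *)
- assert (Hq0 : locally 0 (fun s => Rabs (q s) < 1)).
  { assert (Hq0 : continuous q 0) by (apply Hq; [lra | simpl; lra]).
    generalize (proj1 (filterlim_locally _ _) Hq0 (mkposreal 1 Rlt_0_1)). apply filter_imp.
    intros s Hs. change (Rabs (q s - q 0) < 1) in Hs.
    replace (q 0) with 0 in Hs by (unfold q; ring). now rewrite Rminus_0_r in Hs. }
  destruct Hq0 as [d Hd].
  apply (filterlim_locally (F := at_right 0)). intros eps. unfold at_right, within.
  assert (Hs : continuous sqrt 0) by apply continuous_sqrt.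
  assert (H1 := proj1 (filterlim_locally _ _) Hs d).
  assert (H2 := proj1 (filterlim_locally _ _) Hs eps).
  assert (H3 : locally 0 (fun u => u < b)) by now apply (open_lt b).
  generalize (filter_and _ _ (filter_and _ _ H1 H2) H3). apply filter_imp.
  intros u [[Hud Hue] Hub] Hu.
  assert (Hp : 0 < sqrt u) by (apply sqrt_lt_R0; lra).
  change (Rabs (sqrt u - sqrt 0) < d) in Hud.
  change (Rabs (sqrt u - sqrt 0) < eps) in Hue.
  change (Rabs (RInt q 0 (sqrt u) - 0) < eps).
  rewrite sqrt_0, Rminus_0_r, Rabs_pos_eq in Hud, Hue by lra.
  rewrite Rminus_0_r. eapply Rle_lt_trans; [|exact Hue].
  replace (sqrt u) with ((sqrt u - 0) * 1) at 2 by ring.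
  apply abs_RInt_le_const; [lra | |].
  + exists (RInt q 0 (sqrt u)). apply HI; [lra|]. rewrite Hsqrt; lra.
  + intros s Hsu. left. apply Hd. change (Rabs (s - 0) < d).
    rewrite Rminus_0_r, Rabs_pos_eq; lra.
Qed.

Lemma ln_one_sub_bound (x : R) :
  locally 0 (fun u => Rabs (ln (1 - x * u)) <= (Rabs x + 1) * Rabs u).
Proof.
assert (HD : is_derive (fun u => ln (1 - x * u)) 0 (- x)).
{ auto_derive; [|field]; lra. }
apply is_derive_Reals in HD. destruct (HD 1 Rlt_0_1) as [d Hd].
exists d. intros u Hu. change (Rabs (u - 0) < d) in Hu. rewrite Rminus_0_r in Hu.
destruct (Req_dec u 0) as [->|Hu0].
- rewrite Rmult_0_r, Rminus_0_r, ln_1, Rabs_R0. lra.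
- specialize (Hd u Hu0 Hu).
  rewrite Rplus_0_l, Rmult_0_r, Rminus_0_r, ln_1, Rminus_0_r in Hd.
  replace (ln (1 - x * u)) with (ln (1 - x * u) / u * u) by now field.
  rewrite Rabs_mult. apply Rmult_le_compat_r; [apply Rabs_pos|].
  revert Hd. unfold Rabs. repeat destruct Rcase_abs; lra.
Qed.

(** The boundary term of the integration by parts: one factor [ln (1 - x u)] is
    [O(u)], and [u * ln u ^ m] tends to 0. *)
Lemma ln_pow_mul_ln_pow_at_0 (m k : nat) (x : R) :
  filterlim (fun u => ln u ^ m * ln (1 - x * u) ^ S k) (at_right 0) (locally 0).
Proof.
apply (filterlim_locally (F := at_right 0)). intros eps. unfold at_right, within.
assert (Hc : continuous (fun u => (Rabs x + 1) * ((u * ln u ^ m) * ln (1 - x * u) ^ k)) 0).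
{ apply (continuous_scal_r (V := R_NormedModule) (Rabs x + 1)).
  apply (continuous_mult (K := R_AbsRing)); [apply continuous_mul_ln_pow; lra|].
  apply continuous_pow_comp. apply (ex_derive_continuous (fun u => ln (1 - x * u))).
  auto_derive. lra. }
assert (H1 := proj1 (filterlim_locally _ _) Hc eps).
generalize (filter_and _ _ H1 (ln_one_sub_bound x)). apply filter_imp.
intros u [Hu Hb] Hpos.
match type of Hu with ball ?a _ ?b => change (Rabs (b - a) < eps) in Hu end.
change (Rabs (ln u ^ m * ln (1 - x * u) ^ S k - 0) < eps).
rewrite Rmult_0_l, Rmult_0_l, Rmult_0_r, Rminus_0_r in Hu. rewrite Rminus_0_r.
eapply Rle_lt_trans; [|exact Hu].
simpl. rewrite !Rabs_mult, (Rabs_pos_eq (Rabs x + 1)) by (assert (H := Rabs_pos x); lra).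
assert (H := Rmult_le_pos _ _ (Rabs_pos (ln u ^ m)) (Rabs_pos (ln (1 - x * u) ^ k))).
nra.
Qed.

(** * The Nielsen polylogarithm on the real line *)

(** With [x = 1 - c], the point [1 - x u] stays positive slightly beyond [u = 1],
    so that two-sided derivatives at the endpoint [u = 1] make sense. *)
Lemma one_sub_mul_pos (c u : R) : 0 < c -> 0 <= u < 1 + c -> 0 < 1 - (1 - c) * u.
Proof. intros Hc Hu. nra. Qed.

Lemma Clog_RtoC (r : R) : 0 < r -> Clog (RtoC r) = RtoC (ln r).
Proof.
intros Hr. unfold Clog, Carg. rewrite Cmod_R, Rabs_pos_eq by lra. simpl.
destruct (Rle_dec 0 0) as [_|n]; [|lra].
replace (r / r) with 1 by (field; lra). now rewrite acos_1.
Qed.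

(** Integration by parts, in the form of the antiderivative [H] below: its boundary
    part vanishes at 1 because [ln 1 = 0] and at [0+] by
    [ln_pow_mul_ln_pow_at_0], which leaves a multiple of [B 1]. *)
Lemma nielsen_antiderivative (m k : nat) (c : R) (B : R -> R) : 0 < c ->
  (forall u, 0 < u < 1 + c -> is_derive B u
     (ln u ^ S m * (ln (1 - (1 - c) * u) ^ k / (1 - (1 - c) * u)))) ->
  filterlim B (at_right 0) (locally 0) ->
  nielsen (S m) (k + 1) (RtoC (1 - c)) =
  RtoC ((-1) ^ (m + S k) * (1 - c) / (INR (fact (S m)) * INR (fact k)) * B 1).
Proof.
intros Hc HB HB0. rewrite Nat.add_1_r.
set (x := 1 - c) in *.
assert (Hpos : forall u, 0 <= u < 1 + c -> 0 < 1 - x * u)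
  by (intros u; now apply one_sub_mul_pos).
set (j := fun u => ln u ^ m * ln (1 - x * u) ^ S k / u).
set (a := INR (S k) * x / INR (S m)).
set (H := fun u => / INR (S m) * (ln u ^ S m * ln (1 - x * u) ^ S k) + a * B u).
assert (Hm : INR (S m) <> 0) by now apply not_0_INR.
assert (Hk : INR (S k) <> 0) by now apply not_0_INR.
assert (Hmf := INR_fact_neq_0 m). assert (Hkf := INR_fact_neq_0 k).
assert (HI : is_RInt_gen j (at_right 0) (at_point 1) (a * B 1)).
{ replace (a * B 1) with (H 1 - 0) by (unfold H; rewrite ln_1; simpl (0 ^ S m); ring).
  apply is_RInt_gen_antiderivative; [typeclasses eauto | |].
  - exists (mkposreal 1 Rlt_0_1). intros e He He0 t.
    change (Rabs (e - 0) < 1) in He. rewrite Rminus_0_r, Rabs_pos_eq in He by lra.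
    rewrite Rmin_left, Rmax_right by lra. intros Ht.
    assert (Hxt := Hpos t ltac:(lra)). split.
    + unfold H. evar_last.
      * apply (is_derive_plus (V := R_NormedModule)).
        -- auto_derive; [repeat split; lra | reflexivity].
        -- apply (is_derive_scal B t a). apply HB. lra.
      * match goal with |- plus ?p ?q = _ => change (p + q = j t) end.
        unfold j, a.
        change (match m with O => 1 | S _ => INR m + 1 end) with (INR (S m)).
        change (match k with O => 1 | S _ => INR k + 1 end) with (INR (S k)).
        replace (1 + - (x * t)) with (1 - x * t) by ring.
        rewrite <- !tech_pow_Rmult. field. repeat split; lra.
    + apply (ex_derive_continuous j). unfold j. auto_derive. repeat split; lra.
  - unfold H. replace (locally 0) with (locally (/ INR (S m) * 0 + a * 0)) by (f_equal; ring).
    apply (filterlim_comp_2 (G := locally (/ INR (S m) * 0)) (H := locally (a * 0))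
      (fun u => / INR (S m) * (ln u ^ S m * ln (1 - x * u) ^ S k)) (fun u => a * B u) Rplus).
    + apply (filterlim_comp _ _ _ _ (Rmult (/ INR (S m))) _ (locally 0));
        [apply ln_pow_mul_ln_pow_at_0|].
      apply (filterlim_scal_r (V := R_NormedModule)).
    + apply (filterlim_comp _ _ _ _ (Rmult a) _ (locally 0)); [exact HB0|].
      apply (filterlim_scal_r (V := R_NormedModule)).
    + apply (filterlim_plus (V := R_NormedModule)). }
apply is_RInt_gen_RtoC in HI.
unfold nielsen. erewrite (is_RInt_gen_unique (V := C_R_CompleteNormedModule)).
2:{ refine (is_RInt_gen_ext (V := C_R_CompleteNormedModule) _ _ _ _ HI).
  apply Filter_prod with (fun e => 0 < e < 1) (fun b => b = 1).
  - exists (mkposreal 1 Rlt_0_1). intros e He He0.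
    change (Rabs (e - 0) < 1) in He. rewrite Rminus_0_r, Rabs_pos_eq in He; lra.
  - reflexivity.
  - intros e b He -> t. simpl. rewrite Rmin_left, Rmax_right by lra. intros Ht.
    assert (Hxt := Hpos t ltac:(lra)).
    unfold j. rewrite <- RtoC_mult, <- RtoC_minus, Clog_RtoC by lra.
    rewrite RtoC_div, RtoC_mult, !RtoC_pow by lra. reflexivity. }
rewrite <- RtoC_pow, <- RtoC_div, <- RtoC_mult.
2: apply Rmult_integral_contrapositive_currified; apply INR_fact_neq_0.
f_equal. unfold a. rewrite !fact_simpl, !mult_INR. field. repeat split; assumption.
Qed.

(** * The integrals of powers of [ln (sinh t / sinh z)] *)

(** The condition [0 < t / z <= 1] says that [t] lies between 0 (excluded) and [z]
    whatever the sign of [z]; it treats the two branches of [int0] at once. *)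
Lemma int0_antiderivative (f G : R -> R) (z : R) : z <> 0 ->
  (forall t, 0 < t / z <= 1 -> is_derive G t (f t) /\ continuous f t) ->
  filterlim G (within (fun t => 0 < t / z) (locally 0)) (locally 0) ->
  ex_int0 f z /\ int0 f z = G z.
Proof.
intros Hz HD HG.
assert (Hr : 0 < z -> is_RInt_gen f (at_right 0) (at_point z) (G z)).
{ intros Hz0. rewrite <- (Rminus_0_r (G z)).
  apply is_RInt_gen_antiderivative; [typeclasses eauto | |].
  - exists (mkposreal z Hz0). intros e He He0 t.
    change (Rabs (e - 0) < z) in He. rewrite Rminus_0_r, Rabs_pos_eq in He by lra.
    rewrite Rmin_left, Rmax_right by lra. intros Ht. apply HD. split.
    + apply Rdiv_lt_0_compat; lra.
    + apply Rle_div_l; lra.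
  - intros P HP. change (locally 0 (fun t => 0 < t -> P (G t))).
    assert (HGP : locally 0 (fun t => 0 < t / z -> P (G t))) by exact (HG P HP).
    revert HGP. apply filter_imp. intros t Ht Ht0.
    apply Ht. now apply Rdiv_lt_0_compat. }
assert (Hl : z < 0 -> is_RInt_gen f (at_left 0) (at_point z) (G z)).
{ intros Hz0. rewrite <- (Rminus_0_r (G z)).
  assert (Hq : forall t, t / z = - t / - z) by (intros t; field; lra).
  apply is_RInt_gen_antiderivative; [typeclasses eauto | |].
  - assert (Hz1 : 0 < - z) by lra. exists (mkposreal (- z) Hz1). intros e He He0 t.
    change (Rabs (e - 0) < - z) in He. rewrite Rminus_0_r, Rabs_left in He by lra.
    rewrite Rmin_right, Rmax_left by lra. intros Ht. apply HD. rewrite Hq. split.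
    + apply Rdiv_lt_0_compat; lra.
    + apply Rle_div_l; lra.
  - intros P HP. change (locally 0 (fun t => t < 0 -> P (G t))).
    assert (HGP : locally 0 (fun t => 0 < t / z -> P (G t))) by exact (HG P HP).
    revert HGP. apply filter_imp. intros t Ht Ht0.
    apply Ht. rewrite Hq. apply Rdiv_lt_0_compat; lra. }
split.
- split; intros H; exists (G z); auto.
- unfold int0. destruct (Rlt_dec 0 z) as [H|H].
  + now apply is_RInt_gen_unique, Hr.
  + destruct (Rlt_dec z 0) as [H'|H']; [|lra].
    now apply is_RInt_gen_unique, Hl.
Qed.

Lemma int0_0 (f : R -> R) : ex_int0 f 0 /\ int0 f 0 = 0.
Proof.
split; [split; intros H; lra|]. unfold int0. now repeat (destruct Rlt_dec; [lra|]).
Qed.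

(** With [r = t / z] and [y = 2 s z] the ratio is [(1 - exp (r y)) / (1 - exp y)],
    and the monotonicity of [exp] decides, for either sign of [y]. *)
Lemma exp_ratio_bounds (s z t : R) : s <> 0 -> z <> 0 -> 0 < t / z ->
  0 < (1 - exp (2 * s * t)) / (1 - exp (2 * s * z)) /\
  (t / z <= 1 -> (1 - exp (2 * s * t)) / (1 - exp (2 * s * z)) <= 1).
Proof.
intros Hs Hz Ht.
set (r := t / z) in *. assert (Et : 2 * s * t = r * (2 * s * z)) by (unfold r; field; lra).
rewrite Et. set (y := 2 * s * z).
assert (Hy : y <> 0) by (unfold y; repeat apply Rmult_integral_contrapositive_currified; lra).
assert (H0 := exp_0).
assert (exp_le : forall a b, a <= b -> exp a <= exp b).
{ intros a b [Hab | ->]; [left; now apply exp_increasing | apply Rle_refl]. }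
destruct (Rlt_dec 0 y) as [Hy0|Hy0].
- assert (H1 : 1 < exp (r * y)) by (rewrite <- H0; apply exp_increasing; nra).
  assert (H2 : 1 < exp y) by (rewrite <- H0; apply exp_increasing; lra).
  replace ((1 - exp (r * y)) / (1 - exp y))
    with ((exp (r * y) - 1) / (exp y - 1)) by (field; lra).
  split; [apply Rdiv_lt_0_compat; lra | intros Hr; apply Rle_div_l; [lra|]].
  assert (H3 : exp (r * y) <= exp y) by (apply exp_le; nra). lra.
- assert (H1 : exp (r * y) < 1) by (rewrite <- H0; apply exp_increasing; nra).
  assert (H2 : exp y < 1) by (rewrite <- H0; apply exp_increasing; lra).
  split; [apply Rdiv_lt_0_compat; lra | intros Hr; apply Rle_div_l; [lra|]].
  assert (H3 : exp y <= exp (r * y)) by (apply exp_le; nra). lra.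
Qed.

Lemma one_sub_exp_neq_0 (s z : R) : s <> 0 -> z <> 0 -> 1 - exp (2 * s * z) <> 0.
Proof.
intros Hs Hz H.
assert (Hy : 2 * s * z = 0) by (apply exp_inv; rewrite exp_0; lra).
revert Hy. repeat apply Rmult_integral_contrapositive_currified; lra.
Qed.

(** Holds because [1 - exp (2 s r) = -2 s * exp (s r) * sinh r] when [s] is a
    sign. *)
Lemma sinh_ratio (s z t : R) : s = 1 \/ s = -1 -> z <> 0 ->
  sinh t / sinh z =
  (1 - exp (2 * s * t)) / (1 - exp (2 * s * z)) * exp (s * (z - t)).
Proof.
intros Hs Hz.
assert (Hx : 1 - exp (2 * s * z) <> 0) by (apply one_sub_exp_neq_0; destruct Hs; lra).
assert (E : forall r, 1 - exp (2 * s * r) = - (2 * s) * exp (s * r) * sinh r).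
{ intros r. unfold sinh.
  replace (2 * s * r) with (s * r + s * r) by ring. rewrite exp_plus.
  assert (Hr := exp_pos r). assert (Hr' := exp_Ropp r).
  destruct Hs as [-> | ->].
  - rewrite Rmult_1_l, Hr'. field. lra.
  - replace (-1 * r) with (- r) by ring. rewrite Hr'. field. lra. }
assert (Hz0 : exp (s * z) <> 0) by (apply Rgt_not_eq, exp_pos).
assert (Ht0 : exp (s * t) <> 0) by (apply Rgt_not_eq, exp_pos).
assert (Hs0 : s <> 0) by (destruct Hs; lra).
rewrite E in Hx. rewrite !E.
replace (s * (z - t)) with (s * z + - (s * t)) by ring.
rewrite exp_plus, exp_Ropp. field. repeat split; try assumption.
intros Hsh. apply Hx. rewrite Hsh. ring.
Qed.

Lemma ln_sinh_ratio (s z t : R) : s = 1 \/ s = -1 -> z <> 0 -> 0 < t / z ->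
  ln (sinh t / sinh z) - s * (z - t) = ln ((1 - exp (2 * s * t)) / (1 - exp (2 * s * z))).
Proof.
intros Hs Hz Ht.
assert (Hs0 : s <> 0) by (destruct Hs; lra).
rewrite (sinh_ratio s) by assumption.
rewrite ln_mult, ln_exp; [ring | | apply exp_pos].
now apply exp_ratio_bounds.
Qed.

(** With [u t = (1 - exp (2 s t)) / (1 - c)] one has
    [1 - (1 - c) * u t = exp (2 s t)], so [ln (1 - (1 - c) * u t) ^ k] is
    [(2 s t) ^ k] and the denominator cancels the exponential in [u' t]. *)
Lemma int0_sinh_antiderivative (m k : nat) (s z : R) (B : R -> R) :
  let c := exp (2 * s * z) in
  let f := fun t => t ^ k * (ln (sinh t / sinh z) - s * (z - t)) ^ m in
  s = 1 \/ s = -1 -> z <> 0 ->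
  (forall u, 0 < u < 1 + c -> is_derive B u
     (ln u ^ m * (ln (1 - (1 - c) * u) ^ k / (1 - (1 - c) * u)))) ->
  filterlim B (at_right 0) (locally 0) ->
  ex_int0 f z /\ int0 f z = - (1 - c) / (2 * s) ^ S k * B 1.
Proof.
intros c f Hs Hz HB HB0.
assert (Hs0 : s <> 0) by (destruct Hs; lra).
assert (Hc : 0 < c) by apply exp_pos.
assert (Hx : 1 - c <> 0) by now apply one_sub_exp_neq_0.
set (u := fun t => (1 - exp (2 * s * t)) / (1 - c)).
set (a := - (1 - c) / (2 * s) ^ S k).
replace (a * B 1) with (a * B (u z)) by (unfold u, c; do 2 f_equal; field; exact Hx).
apply (int0_antiderivative f (fun t => a * B (u t))); [exact Hz | |].
- intros t Ht.
  assert (Hu : 0 < u t <= 1) by (split; now apply exp_ratio_bounds).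
  split.
  + evar_last.
    * apply is_derive_scal, (is_derive_comp B u); [apply HB; lra|].
      unfold u. auto_derive; [exact I | reflexivity].
    * unfold f. rewrite (ln_sinh_ratio s) by (assumption || apply Ht). fold c. fold (u t).
      replace (1 - (1 - c) * u t) with (exp (2 * s * t)) by (unfold u; field; exact Hx).
      rewrite ln_exp.
      match goal with |- context [scal ?p ?q] => change (scal p q) with (p * q) end.
      unfold a.
      rewrite (Rpow_mult_distr (2 * s) t), <- tech_pow_Rmult.
      assert (He := exp_pos (2 * s * t)). assert (Hp := pow_nonzero (2 * s) k ltac:(lra)).
      field. repeat split; lra.
  + apply (continuous_mult (K := R_AbsRing)); [apply continuous_pow_comp, continuous_id|].
    apply continuous_pow_comp.
    apply (ex_derive_continuous (fun t => ln (sinh t / sinh z) - s * (z - t))).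
    assert (Hpos : 0 < sinh t / sinh z).
    { rewrite (sinh_ratio s) by assumption.
      apply Rmult_lt_0_compat; [apply Hu | apply exp_pos]. }
    unfold sinh at 1. unfold sinh at 1 in Hpos. auto_derive. exact Hpos.
- apply (filterlim_comp _ _ _ (fun t => B (u t)) (Rmult a) _ (locally 0)).
  2:{ rewrite <- (Rmult_0_r a) at 2. apply (filterlim_scal_r (V := R_NormedModule)). }
  apply (filterlim_comp _ _ _ u B _ (at_right 0)); [|exact HB0].
  assert (Hu : continuous u 0)
    by (apply (ex_derive_continuous u); unfold u; auto_derive; exact I).
  unfold continuous in Hu. replace (u 0) with 0 in Hu
    by (unfold u; rewrite Rmult_0_r, exp_0; field; exact Hx).
  intros P HP. change (locally 0 (fun t => 0 < t / z -> P (u t))).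
  assert (HuP : locally 0 (fun t => 0 < u t -> P (u t))) by exact (Hu _ HP).
  revert HuP. apply filter_imp. intros t Ht Ht0.
  apply Ht. now apply exp_ratio_bounds.
Qed.

(** * The integral formula *)

(** Both identities at once, with [s = 1] and [s = -1].  For [m = 0] the Nielsen
    function is a power of a logarithm and the integrand is [t ^ k]; for [m >= 1]
    both sides are multiples of [B 1].  At [z = 0] both vanish, the multiple on the
    Nielsen side because of its factor [1 - c]. *)
Lemma nielsen_sinh_integral (m k : nat) (s z : R) :
  let f := fun t => t ^ k * (ln (sinh t / sinh z) - s * (z - t)) ^ m in
  s = 1 \/ s = -1 ->
  ex_int0 f z /\
  Cmult (RtoC ((-1) ^ m)) (nielsen m (k + 1) (RtoC (1 - exp (2 * s * z)))) =
  RtoC ((-2 * s) ^ (k + 1) / (INR (fact m) * INR (fact k)) * int0 f z).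
Proof.
intros f Hs.
assert (Hs0 : s <> 0) by (destruct Hs; lra).
assert (Hkf := INR_fact_neq_0 k). assert (Hmf := INR_fact_neq_0 m).
assert (Hp := pow_nonzero (2 * s) (S k) ltac:(lra)).
set (c := exp (2 * s * z)). assert (Hc : 0 < c) by apply exp_pos.
destruct m as [|m].
- assert (Hk : INR (S k) <> 0) by now apply not_0_INR.
  assert (HI : ex_int0 f z /\ int0 f z = z ^ S k / INR (S k)).
  { destruct (Req_dec z 0) as [->|Hz].
    - destruct (int0_0 f) as [H1 H2]. split; [exact H1|]. rewrite H2.
      simpl (0 ^ S k). unfold Rdiv; ring.
    - apply (int0_antiderivative f (fun t => t ^ S k / INR (S k))); [exact Hz | |].
      + intros t Ht. split.
        * unfold f. auto_derive; [exact I|].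
          change (match k with O => 1 | S _ => INR k + 1 end) with (INR (S k)).
          simpl pow. field. exact Hk.
        * apply (continuous_mult (K := R_AbsRing));
            [apply continuous_pow_comp, continuous_id | apply continuous_const].
      + apply (filterlim_filter_le_1 (F := locally 0)); [intros P; apply filter_le_within|].
        assert (Hc0 : continuous (fun t => t ^ S k / INR (S k)) 0)
          by (apply (ex_derive_continuous (fun t => t ^ S k / INR (S k))); auto_derive; exact I).
        unfold continuous in Hc0.
        replace (0 ^ S k / INR (S k)) with 0 in Hc0; [exact Hc0|].
        simpl (0 ^ S k). unfold Rdiv. ring. }
  destruct HI as [HE HI]. split; [exact HE|]. rewrite HI, Nat.add_1_r. unfold nielsen.
  rewrite <- RtoC_minus. replace (1 - (1 - c)) with c by ring.
  rewrite Clog_RtoC by exact Hc. unfold c at 1. rewrite ln_exp.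
  rewrite <- !RtoC_pow, <- RtoC_div, <- !RtoC_mult by apply INR_fact_neq_0.
  f_equal. rewrite fact_simpl, mult_INR.
  replace (-2 * s) with (-1 * (2 * s)) by ring. rewrite !Rpow_mult_distr.
  simpl (INR (fact 0)). simpl ((-1) ^ 0). field. auto.
- destruct (ln_pow_antiderivative (S m) (1 + c)
    (fun u => ln (1 - (1 - c) * u) ^ k / (1 - (1 - c) * u))) as [B [HB HB0]]; [lra | |].
  { intros u Hu. assert (Hx := one_sub_mul_pos c u Hc Hu).
    apply (ex_derive_continuous (fun u => ln (1 - (1 - c) * u) ^ k / (1 - (1 - c) * u))).
    auto_derive. repeat split; lra. }
  rewrite (nielsen_antiderivative m k c B Hc HB HB0), <- RtoC_mult.
  assert (HI : ex_int0 f z /\ int0 f z = - (1 - c) / (2 * s) ^ S k * B 1).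
  { destruct (Req_dec z 0) as [->|Hz].
    - destruct (int0_0 f) as [H1 H2]. split; [exact H1|]. rewrite H2. unfold c.
      rewrite Rmult_0_r, exp_0. unfold Rdiv; ring.
    - now apply int0_sinh_antiderivative. }
  destruct HI as [HE HI]. split; [exact HE|]. rewrite HI, Nat.add_1_r.
  f_equal.
  replace (-2 * s) with (-1 * (2 * s)) by ring. rewrite (Rpow_mult_distr (-1)).
  assert (Hsq : (-1) ^ m * (-1) ^ m = 1)
    by (rewrite <- Rpow_mult_distr; replace (-1 * -1) with 1 by ring; apply pow1).
  rewrite pow_add, <- (tech_pow_Rmult (-1) m).
  transitivity (((-1) ^ m * (-1) ^ m) *
    ((-1) * (-1) ^ S k * (1 - c) / (INR (fact (S m)) * INR (fact k)) * B 1)).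
  + field. auto.
  + rewrite Hsq. field. auto.
Qed.

Theorem theorem5p1 : forall (m k : nat) (z : R),
  let f := fun t : R => t ^ k * (ln (sinh t / sinh z) - (z - t)) ^ m in
  let g := fun t : R => t ^ k * (ln (sinh t / sinh z) + (z - t)) ^ m in
  (ex_int0 f z /\
   Cmult (RtoC ((-1) ^ m)) (nielsen m (k + 1) (RtoC (1 - exp (2 * z))))
   = RtoC ((-2) ^ (k + 1) / (INR (fact m) * INR (fact k)) * int0 f z)) /\
  (ex_int0 g z /\
   Cmult (RtoC ((-1) ^ m)) (nielsen m (k + 1) (RtoC (1 - exp (- (2 * z)))))
   = RtoC (2 ^ (k + 1) / (INR (fact m) * INR (fact k)) * int0 g z)).
Proof.
intros m k z f g.
assert (Hf : f = fun t => t ^ k * (ln (sinh t / sinh z) - 1 * (z - t)) ^ m).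
{ apply functional_extensionality. intros t. unfold f. do 2 f_equal. ring. }
assert (Hg : g = fun t => t ^ k * (ln (sinh t / sinh z) - -1 * (z - t)) ^ m).
{ apply functional_extensionality. intros t. unfold g. do 2 f_equal. ring. }
rewrite Hf, Hg. split.
- replace (2 * z) with (2 * 1 * z) by ring. replace (-2) with (-2 * 1) by ring.
  apply nielsen_sinh_integral. now left.
- replace (- (2 * z)) with (2 * -1 * z) by ring. replace 2 with (-2 * -1) at 2 by ring.
  apply nielsen_sinh_integral. now right.
Qed.
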